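(* Let $q_n=|\mathcal{Q}_n|$ and let $r(n)$ be the number of $(-1)$-Dyck paths of semi-length $n$. Then: (1) For $n>3$, $$q_n=2 q_{n-1}+q_{n-2}+q_{n-3}+\sum _{i=2}^{n-4} q_{i} (q_{n-i-1}-q_{n-i-2})+1,$$ with the initial values $q_1=0$, $q_2=1$, and $q_3=3$. (2) For $n>3$, $$r(n)=3 r(n-1)-r(n-2)+q_{n-2}+\sum _{i=2}^{n-3} q_{i} (r(n-i-1)-r(n-i-2)),$$ with the initial values $r(1)=1$, $r(2)=2$, and $r(3)=5$.
   Context: A Dyck path is a lattice path in the first quadrant that starts at the origin, ends on the $x$-axis, and consists of steps $U=(1,1)$ and $D=(1,-1)$ (never going below the $x$-axis). Its semi-length is its number of $U$ steps. A valley is an occurrence of two consecutive steps $DU$; the level of a valley is the $y$-coordinate of its lowest point. Let $\nu=(\nu_1,\dots,\nu_k)$ be the levels of all valleys of $P$, listed from left to right. A Dyck path is called $(-1)$-Dyck if it has at most one valley or if $\nu_{i+1}-\nu_i\ge -1$ for all $1\le i<k$. $\mathcal{Q}_n$ is the set of all $(-1)$-Dyck paths of semi-length $n$ that have at least one valley and whose last (rightmost) valley is at ground level (level $0$). Sums whose upper limit is smaller than the lower limit are empty. *)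

(* Defs.v *)
From mathcomp Require Import all_boot all_order all_algebra.

Set Implicit Arguments.
Unset Strict Implicit.
Unset Printing Implicit Defensive.

Import Order.TTheory GRing.Theory Num.Theory.
Local Open Scope ring_scope.

(* A lattice path from the origin is the sequence of its steps: *)
(* [true] is U = (1, 1), [false] is D = (1, -1).                *)
Definition step := bool.
Definition U : step := true.
Definition D : step := false.

Definition rise (s : step) : int := if s == U then 1 else -1.

(* y-coordinate after the first i steps *)
Definition height (P : seq step) (i : nat) : int :=
  \sum_(s <- take i P) rise s.

Definition dyck (P : seq step) : bool :=
  [forall i : 'I_(size P).+1, 0 <= height P i] && (height P (size P) == 0).

Definition semilength (P : seq step) : nat := count_mem U P.

(* Steps are numbered from 0; the lowest point of the valley formed by *)
(* steps i and i.+1 is the point reached after i.+1 steps.             *)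
Definition valley_at (P : seq step) (i : nat) : bool :=
  [&& (i.+1 < size P)%N, nth U P i == D & nth D P i.+1 == U].

Definition valley_levels (P : seq step) : seq int :=
  [seq height P i.+1 | i <- iota 0 (size P) & valley_at P i].

Definition m1dyck (P : seq step) : bool :=
  let nu := valley_levels P in
  dyck P && ((size nu <= 1)%N || sorted (fun a b : int => -1 <= b - a) nu).

Definition last_valley_ground (P : seq step) : bool :=
  let nu := valley_levels P in (nu != [::]) && (last 0 nu == 0).

(* A Dyck path of semi-length n has exactly 2n steps. *)
Definition m1dyck_set (n : nat) : {set n.*2.-tuple step} :=
  [set P : n.*2.-tuple step | m1dyck P && (semilength P == n)].

Definition Qset (n : nat) : {set n.*2.-tuple step} :=
  [set P in m1dyck_set n | last_valley_ground P].

Definition r (n : nat) : nat := #|m1dyck_set n|.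
Definition q (n : nat) : nat := #|Qset n|.

(* Main.v *)
Require Import Defs.
From mathcomp Require Import all_boot all_order all_algebra.
From mathcomp Require Import zify ring.

Set Implicit Arguments.
Unset Strict Implicit.
Unset Printing Implicit Defensive.

Import Order.TTheory GRing.Theory Num.Theory.
Local Open Scope ring_scope.

(** Every nonempty Dyck path decomposes uniquely at its first return to the
axis as P = U A D B with A and B Dyck. The valley levels of P are those of A
raised by 1, followed, when B is nonempty, by 0 and the levels of B
([valley_levels_first_return]). Call a (-1)-Dyck path grounded if it has no
valley or its last valley is at level 0. For nonempty B the condition on
consecutive valleys can newly fail only between the last valley of A, which
sits at level at least 1 in P, and the valley following the first return;
hence P is (-1)-Dyck iff A is grounded and B is (-1)-Dyck, and P is grounded
iff A and B both are. For empty B, P is (-1)-Dyck iff A is, and its last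
valley, if any, is above the axis.

There is exactly one Dyck path of semi-length n without valleys, so q n + 1
paths are grounded, and counting pairs (A, B) gives the convolutions

  r (n + 1) = r n + sum_(a < n) (q a + 1) r (n - a)        ([r_rec]),
  q (n + 1) = sum_(a < n) (q a + 1) (q (n - a) + 1)        ([q_rec]).

Subtracting two consecutive instances of each ([convolution_diff]) turns the
summands 1 of (q a + 1) into a telescoping sum, which leaves the stated
recurrences up to boundary terms, evaluated with q 0 = q 1 = 0 and q 2 = 1. *)

(** * Dyck paths and first returns *)

(** [descends h P]: started at height [h], the path [P] never goes below the
axis and ends on it. Dyck paths are the case [h = 0]; a general starting
height is what makes induction on the steps possible. *)
Fixpoint descends (h : nat) (P : seq step) : bool :=
  match P, h with
  | [::], _ => h == 0%N
  | true :: P', _ => descends h.+1 P'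
  | false :: P', h'.+1 => descends h' P'
  | false :: _, 0%N => false
  end.

Lemma height0 P : height P 0 = 0.
Proof. by rewrite /height take0 big_nil. Qed.

Lemma height_cons s P i : height (s :: P) i.+1 = rise s + height P i.
Proof. by rewrite /height /= big_cons. Qed.

Lemma descendsP h P :
  reflect ((forall i, (i <= size P)%N -> 0 <= h%:Z + height P i)
           /\ h%:Z + height P (size P) = 0)
          (descends h P).
Proof.
apply: (iffP idP); elim: P h => [|[] P IH] h /=.
- by move=> /eqP->; split=> [i|]; rewrite /height /= big_nil.
- move=> /IH[nn z0]; split=> [[|i] le_i|]; rewrite ?height0 ?height_cons /rise /=.
  + lia.
  + by have := nn i le_i; lia.
  + lia.
- case: h => // h /IH[nn z0].
  split=> [[|i] le_i|]; rewrite ?height0 ?height_cons /rise /=.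
  + lia.
  + by have := nn i le_i; lia.
  + lia.
- by case=> _; rewrite height0; lia.
- case=> nn z0; apply: IH; split=> [i le_i|].
  + by have := nn i.+1 le_i; rewrite height_cons /rise /=; lia.
  + by move: z0; rewrite height_cons /rise /=; lia.
- case=> nn z0; case: h nn z0 => [|h] nn z0.
    by have := nn 1%N isT; rewrite height_cons height0 /rise /=; lia.
  apply: IH; split=> [i le_i|].
  + by have := nn i.+1 le_i; rewrite height_cons /rise /=; lia.
  + by move: z0; rewrite height_cons /rise /=; lia.
Qed.

Lemma dyckE P : dyck P = descends 0 P.
Proof.
apply/andP/descendsP => [[/forallP nn /eqP z0]|[nn z0]]; split.
- by move=> i le_i; rewrite add0r; apply: (nn (Ordinal (le_i : (i < _.+1)%N))).
- by rewrite add0r.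
- by apply/forallP => i; rewrite -[height _ _]add0r; apply: nn; rewrite -ltnS.
- by rewrite -z0 add0r.
Qed.

Lemma dyck_nil : dyck [::].
Proof. by rewrite dyckE. Qed.

Lemma size_descends h P :
  descends h P -> size P = (h + (semilength P).*2)%N.
Proof.
elim: P h => [|[] P IH] h /=; first by move/eqP->.
  by move/IH=> ->; rewrite /semilength /=; lia.
by case: h => // h /IH ->; rewrite /semilength /=; lia.
Qed.

Lemma height_dyck P : dyck P -> \sum_(s <- P) rise s = 0.
Proof. by case/andP=> _ /eqP; rewrite /height take_size. Qed.

(** A path descending from [k] to the axis, raised by [h.+1] and continued by a
D step, reaches height [h], from where [B] has to take over. *)
Lemma descends_cat k h A B :
  descends k A -> descends (k + h.+1) (A ++ D :: B) = descends h B.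
Proof.
elim: A k => [|[] A IH] k /=; first by move/eqP->.
  by move/IH.
by case: k => // k kA; exact: IH.
Qed.

(** Existence of the decomposition: a path that starts at height
[k + h.+1] and descends to the axis is cut at the first step going below height
[h.+1]. *)
Lemma descends_split k h P :
  descends (k + h.+1) P ->
  exists A B, [/\ P = A ++ D :: B, descends k A & descends h B].
Proof.
elim: P k => [|[] P IH] k /=; first by rewrite addnS.
  by move=> /(IH k.+1)[A [B [-> kA hB]]]; exists (U :: A), B.
case: k => [|k] /=; first by exists [::], P.
by move=> /(IH k)[A [B [-> kA hB]]]; exists (D :: A), B.
Qed.

(** Uniqueness of that cut: the separating D step is the first one that takes
the path below the axis on which [A] ends. *)
Lemma descends_inj k A A' B B' :
  descends k A -> descends k A' -> A ++ D :: B = A' ++ D :: B' ->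
  A = A' /\ B = B'.
Proof.
elim: A A' k => [|s A IH] [|s' A'] k /=.
- by move=> _ _ [].
- by move=> /eqP-> k0 [e _]; rewrite -e in k0.
- by move=> k0 /eqP k_0 [e _]; rewrite e k_0 in k0.
move=> kA kA' [ss']; subst s'.
case: s kA kA' => [|]; last case: k => // k; move=> kA kA' /(IH _ _ kA kA').
  by case=> -> ->.
by case=> -> ->.
Qed.

(** The path made of an elevated copy of [A] followed by [B]. *)
Definition first_return (A B : seq step) : seq step := U :: A ++ D :: B.

Lemma dyck_first_return A B : dyck A -> dyck (first_return A B) = dyck B.
Proof. by rewrite !dyckE => /(descends_cat 0 B). Qed.

Lemma dyck_split P :
  dyck P -> P != [::] ->
  exists A B, [/\ P = first_return A B, dyck A & dyck B].
Proof.
case: P => [|[] P] //; rewrite dyckE //= => /(@descends_split 0 0 P).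
by case=> A [B [-> dA dB]] _; exists A, B; rewrite !dyckE.
Qed.

(** * Enumeration of Dyck paths *)

(** The Dyck paths of semi-length [n], listed without repetition. Using plain
sequences rather than tuples avoids casts when paths are cut or glued. *)
Definition dyck_words (n : nat) : seq (seq step) :=
  [seq P <- map val (enum {: n.*2.-tuple step}) | dyck P].

Lemma mem_dyck_words n P : (P \in dyck_words n) = dyck P && (size P == n.*2).
Proof.
rewrite mem_filter; congr (_ && _); apply/mapP/idP => [[w _ ->]|sP].
  by rewrite size_tuple.
by exists (Tuple sP); rewrite ?mem_enum.
Qed.

Lemma dyck_words_uniq n : uniq (dyck_words n).
Proof. by rewrite filter_uniq // map_inj_uniq ?enum_uniq //; apply: val_inj. Qed.

Lemma card_dyck_words n (p : pred (seq step)) :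
  #|[set P : n.*2.-tuple step | dyck P && p P]| = count p (dyck_words n).
Proof.
rewrite cardE -size_filter /dyck_words -filter_predI filter_map size_map.
rewrite enumT /enum_mem -enumT; congr size; apply: eq_filter => P.
by rewrite /= inE andbC.
Qed.

Lemma semilength_dyck n P : dyck P -> size P = n.*2 -> semilength P = n.
Proof.
rewrite dyckE => /size_descends -> /eqP.
by rewrite add0n (inj_eq double_inj) => /eqP.
Qed.

Lemma dyck_words0 : dyck_words 0 = [:: [::]].
Proof.
apply: perm_small_eq => //.
apply: uniq_perm => [||P]; rewrite ?dyck_words_uniq //.
rewrite mem_dyck_words inE size_eq0; case: eqP => [->|]; rewrite ?andbF //.
by rewrite dyckE.
Qed.

(** The first-return decomposition as a bijection; [a] is the semi-length of
the elevated part. *)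
Lemma dyck_wordsS n :
  perm_eq (dyck_words n.+1)
    [seq first_return AB.1 AB.2 | a <- iota 0 n.+1,
       AB <- [seq (A, B) | A <- dyck_words a, B <- dyck_words (n - a)]].
Proof.
apply: uniq_perm.
- exact: dyck_words_uniq.
- apply: allpairs_uniq_dep => [|a _|].
  + exact: iota_uniq.
  + by apply: allpairs_uniq; rewrite ?dyck_words_uniq // => -[? ?] [? ?].
  (* The index a is recovered from A, whose length is 2a. *)
  have fst_size (a : nat) (AB : seq step * seq step) :
      AB \in [seq (A, B) | A <- dyck_words a, B <- dyck_words (n - a)] ->
      dyck AB.1 /\ size AB.1 = a.*2.
    case/allpairsP=> -[A B] [/= + _ ->].
    by rewrite mem_dyck_words => /andP[dA /eqP].
  move=> _ AB' /allpairsPdep[a [[A B] [_ /fst_size[dA sA] ->]]].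
  case/allpairsPdep=> a' [[A' B'] [_ /fst_size[dA' sA'] ->]].
  move: dA sA dA' sA' => /= dA sA dA' sA' [].
  move: (dA) (dA'); rewrite !dyckE => kA kA' /(descends_inj kA kA')[eA ->].
  by rewrite eA; have -> : a = a' by apply: double_inj; rewrite -sA -sA' eA.
move=> P; rewrite mem_dyck_words; apply/andP/allpairsPdep.
  case=> dP /eqP sP.
  have [|A [B [eP dA dB]]] := dyck_split dP; first by rewrite -size_eq0 sP.
  move: (dA) (dB); rewrite !dyckE => /size_descends sA /size_descends sB.
  rewrite eP /= size_cat /= sA sB in sP.
  exists (semilength A), (A, B); split=> //; first by rewrite mem_iota; lia.
  apply/allpairsP; exists (A, B); rewrite /= !mem_dyck_words dA dB sA sB.
  by split => //; lia.
case=> a [_ [+ /allpairsP[[A B] [/= + + ->]] ->]] /=.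
rewrite !mem_dyck_words mem_iota => la /andP[dA /eqP sA] /andP[dB /eqP sB].
rewrite dyck_first_return // /= size_cat /= sA sB; split => //.
by lia.
Qed.

(** * Counting along the first-return decomposition *)

(** The pairs with empty second component, i.e. [a = n], are kept apart. *)
Lemma count_dyck_wordsS n (p : pred (seq step)) :
  count p (dyck_words n.+1) =
  (\sum_(a < n) \sum_(A <- dyck_words a) \sum_(B <- dyck_words (n - a))
      p (first_return A B)
   + count (fun A => p (first_return A [::])) (dyck_words n))%N.
Proof.
have sum_count (I : Type) (s : seq I) (b : pred I) :
    count b s = (\sum_(i <- s) b i)%N.
  by rewrite -sum1_count big_mkcond.
rewrite (permP (dyck_wordsS n)) sum_count big_allpairs_dep.
rewrite -[iota 0 n.+1]/(index_iota 0 n.+1) big_nat_recr //= big_mkord; congr addn.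
  by apply: eq_bigr => a _; rewrite big_allpairs.
rewrite big_allpairs subnn dyck_words0 sum_count.
by apply: eq_bigr => A _; rewrite big_seq1.
Qed.

(** If, on a decomposition with nonempty [B], the property [p] amounts to
independent properties of [A] and [B], its count is a convolution. *)
Lemma count_first_return n (p pA pB p0 : pred (seq step)) :
  (forall A B, dyck A -> dyck B -> B != [::] ->
     p (first_return A B) = pA A && pB B) ->
  (forall A, dyck A -> p (first_return A [::]) = p0 A) ->
  count p (dyck_words n.+1) =
  (\sum_(a < n) count pA (dyck_words a) * count pB (dyck_words (n - a))
   + count p0 (dyck_words n))%N.
Proof.
move=> p_split p_nil; rewrite count_dyck_wordsS; congr addn; last first.
  by apply: eq_in_count => A; rewrite mem_dyck_words => /andP[/p_nil].
apply: eq_bigr => a _.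
rewrite -!sum1_count !(big_mkcond _ (fun=> 1%N)) /= big_distrl /=.
rewrite big_seq [RHS]big_seq; apply: eq_bigr => A.
rewrite mem_dyck_words => /andP[dA _]; rewrite big_distrr /=.
rewrite big_seq [RHS]big_seq; apply: eq_bigr => B.
rewrite mem_dyck_words => /andP[dB /eqP sB]; rewrite p_split //.
  by case: (pA A); case: (pB B).
by rewrite -size_eq0 sB double_eq0 subn_eq0 -ltnNge.
Qed.

(** * Valley levels of a first-return decomposition *)

(** The default D of [head] is right for a final D step, which starts no
valley. *)
Lemma valley_levels_cons s P :
  valley_levels (s :: P) =
  (if (s == D) && (head D P == U) then [:: -1] else [::])
  ++ [seq rise s + x | x <- valley_levels P].
Proof.
have v0 : valley_at (s :: P) 0 = (s == D) && (head D P == U).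
  by case: P => [|s' P]; rewrite /valley_at //= andbF.
have h1 : height (s :: P) 1 = rise s by rewrite height_cons height0 addr0.
have levelS :
    [seq height (s :: P) i.+1
       | i <- [seq i <- map (addn 1) (iota 0 (size P)) | valley_at (s :: P) i]]
    = [seq rise s + x | x <- valley_levels P].
  rewrite filter_map -!map_comp; apply: eq_map => i.
  by rewrite /= add1n height_cons.
rewrite -levelS /valley_levels /= (iotaDl 1) v0.
by case: andP => // -[/eqP eD _]; rewrite /= h1 eD.
Qed.

(** No valley straddles the cut, because the second factor begins with D. *)
Lemma valley_levels_cat A B :
  valley_levels (A ++ D :: B) =
  valley_levels A
  ++ [seq \sum_(s <- A) rise s + x | x <- valley_levels (D :: B)].
Proof.
elim: A => [|s A IH].
  by rewrite big_nil (eq_map (@add0r _)) map_id.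
rewrite cat_cons valley_levels_cons IH [valley_levels (s :: A)]valley_levels_cons.
rewrite map_cat big_cons -catA; congr (_ ++ (_ ++ _)).
  by case: A {IH} => //=; rewrite andbF.
by rewrite -map_comp; apply: eq_map => x /=; rewrite addrA.
Qed.

Lemma valley_levels_first_return A B :
  dyck A -> dyck B ->
  valley_levels (first_return A B) =
  [seq 1 + x | x <- valley_levels A]
  ++ (if B is [::] then [::] else 0 :: valley_levels B).
Proof.
move=> dA dB; rewrite valley_levels_cons /= valley_levels_cat height_dyck //.
rewrite valley_levels_cons map_cat; congr (_ ++ _).
have shiftK (t : seq int) :
    [seq rise U + x | x <- [seq 0 + x | x <- [seq rise D + x | x <- t]]] = t.
  by rewrite -!map_comp -[RHS]map_id; apply: eq_map => x; rewrite /rise /=; lia.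
rewrite !map_cat shiftK.
by case: B dB => [|[] B] //; rewrite dyckE.
Qed.

(** Valleys are at heights reached by the path. *)
Lemma valley_levels_ge0 P : dyck P -> all (fun x => 0 <= x) (valley_levels P).
Proof.
move=> /andP[/forallP nn _]; apply/allP => _ /mapP[i + ->].
rewrite mem_filter mem_iota add0n => /and3P[_ _ lt_i].
exact: (nn (Ordinal (lt_i : (i.+1 < _.+1)%N))).
Qed.

(** * (-1)-Dyck and grounded paths *)

(** The condition on consecutive valley levels defining (-1)-Dyck paths; it
holds trivially when there is at most one valley. *)
Definition m1_levels (P : seq step) : bool :=
  sorted (fun a b : int => -1 <= b - a) (valley_levels P).

(** No valley, or the last valley at level 0; the default 0 of [last] covers
the first case. *)
Definition grounded (P : seq step) : bool :=
  m1_levels P && (last 0 (valley_levels P) == 0).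

(** For Dyck paths of semi-length n this singles out the path U^n D^n. *)
Definition valleyless (P : seq step) : bool := valley_levels P == [::].

Lemma m1dyckE P : m1dyck P = dyck P && m1_levels P.
Proof.
rewrite /m1dyck /m1_levels; case: (dyck P) => //=.
by case: (valley_levels P) => [|x [|y s]].
Qed.

Lemma m1_levels_first_return_nil A :
  dyck A -> m1_levels (first_return A [::]) = m1_levels A.
Proof.
move=> dA; rewrite /m1_levels valley_levels_first_return ?dyck_nil // cats0.
by rewrite sorted_map; apply: eq_sorted => x y /=; congr (_ <= _); lia.
Qed.

(** The valley at the first return is at level 0, so the condition on the valley
before it forces the last level [x >= 0] of [A], raised to [x + 1], to satisfy
[x + 1 <= 1], while the valley after it is unconstrained. *)
Lemma m1_levels_first_return A B :
  dyck A -> dyck B -> B != [::] ->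
  m1_levels (first_return A B) = grounded A && m1_levels B.
Proof.
move=> dA dB nB; rewrite /grounded /m1_levels valley_levels_first_return //.
case: B dB nB => // s B dB _; rewrite sorted_cat_cons; congr (_ && _); last first.
  apply: path_min_sorted; apply: sub_all (valley_levels_ge0 dB) => x /=; lia.
have shift_sorted t : sorted (fun a b : int => -1 <= b - a) [seq 1 + x | x <- t]
    = sorted (fun a b : int => -1 <= b - a) t.
  by rewrite sorted_map; apply: eq_sorted => x y /=; congr (_ <= _); lia.
have := valley_levels_ge0 dA; rewrite -(shift_sorted (valley_levels A)).
case/lastP: (valley_levels A) => // t x; rewrite all_rcons => /andP[x_ge0 _].
rewrite map_rcons last_rcons -[rcons (rcons _ _) _]cats1 cat_rcons.
rewrite sorted_cat_cons /= andbT.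
by congr (_ && _); move: x_ge0; lia.
Qed.

Lemma last_levels_first_return A B :
  dyck A -> dyck B -> B != [::] ->
  last 0 (valley_levels (first_return A B)) = last 0 (valley_levels B).
Proof.
move=> dA dB; rewrite valley_levels_first_return //.
by case: B dB => // s B _ _; rewrite last_cat.
Qed.

Lemma last_valley_ground_first_return A B :
  dyck A -> dyck B -> B != [::] ->
  last_valley_ground (first_return A B) = (last 0 (valley_levels B) == 0).
Proof.
move=> dA dB nB; rewrite /last_valley_ground last_levels_first_return //.
rewrite valley_levels_first_return //; case: B dB nB => // s B _ _.
by case: (valley_levels A).
Qed.

Lemma last_valley_ground_first_return_nil A :
  dyck A -> last_valley_ground (first_return A [::]) = false.
Proof.
move=> dA; have := valley_levels_ge0 dA.
rewrite /last_valley_ground valley_levels_first_return ?dyck_nil // cats0.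
case/lastP: (valley_levels A) => // t x; rewrite all_rcons => /andP[x_ge0 _].
by rewrite map_rcons last_rcons; case: eqP => //=; lia.
Qed.

(** * Convolution recurrences for the two counts *)

Lemma r_count n : r n = count m1_levels (dyck_words n).
Proof.
rewrite -card_dyck_words; apply: eq_card => P; rewrite !inE m1dyckE.
case dP: (dyck P) => //=.
by rewrite (semilength_dyck dP (size_tuple P)) eqxx andbT.
Qed.

Lemma q_count n :
  q n = count (predI m1_levels last_valley_ground) (dyck_words n).
Proof.
rewrite -card_dyck_words; apply: eq_card => P; rewrite !inE m1dyckE.
case dP: (dyck P) => //=.
by rewrite (semilength_dyck dP (size_tuple P)) eqxx andbT.
Qed.

(** A valleyless Dyck path returns to the axis only at its end, and what it
elevates is again valleyless. *)
Lemma count_valleyless n : count valleyless (dyck_words n) = 1%N.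
Proof.
elim: n => [|n IH]; first by rewrite dyck_words0.
rewrite (@count_first_return _ _ pred0 pred0 valleyless).
- by rewrite IH big1 // => a _; rewrite count_pred0.
- move=> A B dA dB; rewrite /valleyless valley_levels_first_return //.
  by case: B dB => // s B _ _; case: (valley_levels A).
move=> A dA; rewrite /valleyless valley_levels_first_return ?dyck_nil // cats0.
by case: (valley_levels A).
Qed.

Lemma count_grounded n : count grounded (dyck_words n) = (q n).+1.
Proof.
rewrite q_count -addn1 -(count_valleyless n) -count_predUI.
rewrite [X in (_ + X)%N](eq_count (a2 := pred0)) ?count_pred0 ?addn0.
  apply: eq_count => P; rewrite /grounded /= /valleyless /last_valley_ground.
  by rewrite /m1_levels; case: (valley_levels P) => [|x t]; rewrite /= ?orbF.
move=> P; rewrite /= /valleyless /last_valley_ground.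
by case: (valley_levels P) => [|x t]; rewrite /= ?andbF.
Qed.

Lemma r_rec n :
  r n.+1 = (\sum_(a < n) (q a).+1 * r (n - a) + r n)%N.
Proof.
rewrite !r_count (@count_first_return _ _ grounded m1_levels m1_levels).
- by congr addn; apply: eq_bigr => a _; rewrite count_grounded r_count.
- exact: m1_levels_first_return.
- exact: m1_levels_first_return_nil.
Qed.

Lemma q_rec n :
  q n.+1 = (\sum_(a < n) (q a).+1 * (q (n - a)).+1)%N.
Proof.
rewrite q_count (@count_first_return _ _ grounded grounded pred0).
- rewrite count_pred0 addn0.
  by apply: eq_bigr => a _; rewrite !count_grounded.
- move=> A B dA dB nB; rewrite /= m1_levels_first_return //.
  by rewrite last_valley_ground_first_return // -andbA.
- by move=> A dA; rewrite /= last_valley_ground_first_return_nil // andbF.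
Qed.

Lemma r0 : r 0 = 1%N.
Proof. by rewrite r_count dyck_words0. Qed.

Lemma q0 : q 0 = 0%N.
Proof. by rewrite q_count dyck_words0. Qed.

Lemma q1 : q 1 = 0%N.
Proof. by rewrite q_rec big_ord0. Qed.

Lemma q2 : q 2 = 1%N.
Proof. by rewrite q_rec !big_ord_recl big_ord0 /= q0 q1. Qed.

Lemma q3 : q 3 = 3%N.
Proof. by rewrite q_rec !big_ord_recl big_ord0 /= q0 q1 q2. Qed.

Lemma r1 : r 1 = 1%N.
Proof. by rewrite r_rec big_ord0 r0. Qed.

Lemma r2 : r 2 = 2%N.
Proof. by rewrite r_rec !big_ord_recl big_ord0 /= q0 r1. Qed.

Lemma r3 : r 3 = 5%N.
Proof. by rewrite r_rec !big_ord_recl big_ord0 /= q0 q1 r1 r2. Qed.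

(** * From convolutions to the recurrences by differences *)

Lemma telescope_sum_rev (V : zmodType) (f : nat -> V) k :
  \sum_(0 <= a < k) (f (k.+1 - a)%N - f (k - a)%N) = f k.+1 - f 1%N.
Proof.
elim: k => [|k IH]; first by rewrite big_geq // subrr.
by rewrite big_nat_recl // !subn0 IH addrA subrK.
Qed.

(** The summand 1 of [u a + 1] contributes the telescoping sum
[f k.+1 - f 1]; the last term of the longer convolution is
[(u k + 1) * f 1]. *)
Lemma convolution_diff (R : comNzRingType) (u f : nat -> R) k :
  \sum_(a < k.+1) (u a + 1) * f (k.+1 - a)%N
    - \sum_(a < k) (u a + 1) * f (k - a)%N
  = \sum_(0 <= a < k) u a * (f (k.+1 - a)%N - f (k - a)%N)
    + f k.+1 + u k * f 1%N.
Proof.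
rewrite big_ord_recr /= subSnn addrAC -sumrB.
rewrite -(big_mkord xpredT
  (fun a => (u a + 1) * f (k.+1 - a)%N - (u a + 1) * f (k - a)%N)).
have split_term a : (u a + 1) * f (k.+1 - a)%N - (u a + 1) * f (k - a)%N
  = u a * (f (k.+1 - a)%N - f (k - a)%N) + (f (k.+1 - a)%N - f (k - a)%N).
  by ring.
under eq_bigr do rewrite split_term.
rewrite big_split /= telescope_sum_rev; ring.
Qed.

(** Here the convolved sequence is [f n = q n + 1], whose differences are those
of [q], with [f 1 = 1]. *)
Lemma q_recZ k :
  (q k.+2)%:Z = 2 * (q k.+1)%:Z + (q k)%:Z + 1
    + \sum_(0 <= a < k) (q a)%:Z * ((q (k.+1 - a))%:Z - (q (k - a))%:Z).
Proof.
have recZ n : (q n.+1)%:Z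
    = \sum_(a < n) ((q a)%:Z + 1) * ((q (n - a))%:Z + 1).
  rewrite q_rec -[LHS]natz natr_sum; apply: eq_bigr => a _.
  by rewrite natrM !natz; congr (_ * _); lia.
have := convolution_diff (fun n => (q n)%:Z) (fun n => (q n)%:Z + 1) k.
rewrite -!recZ q1.
have sub1 (x y : int) : x + 1 - (y + 1) = x - y by lia.
under eq_bigr do rewrite sub1.
move: (\sum_(_ <= a < _) _) => S; lia.
Qed.

Lemma r_recZ k :
  (r k.+2)%:Z = 3 * (r k.+1)%:Z - (r k)%:Z + (q k)%:Z
    + \sum_(0 <= a < k) (q a)%:Z * ((r (k.+1 - a))%:Z - (r (k - a))%:Z).
Proof.
have recZ n : (r n.+1)%:Z
    = \sum_(a < n) ((q a)%:Z + 1) * (r (n - a))%:Z + (r n)%:Z.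
  rewrite r_rec PoszD; congr (_ + _).
  rewrite -[LHS]natz natr_sum; apply: eq_bigr => a _.
  by rewrite natrM !natz; congr (_ * _); lia.
have := convolution_diff (fun n => (q n)%:Z) (fun n => (r n)%:Z) k.
have := recZ k; have := recZ k.+1; rewrite r1.
move: (\sum_(_ <= a < _) _) (\sum_(a < _) _) (\sum_(a < _) _) => S S1 S2; lia.
Qed.

Theorem corollary3p5 :
  ((forall n : nat, (3 < n)%N ->
      (q n)%:Z = 2 * (q (n - 1))%:Z + (q (n - 2))%:Z + (q (n - 3))%:Z
        + \sum_(2 <= i < (n - 4).+1)
            (q i)%:Z * ((q (n - i - 1))%:Z - (q (n - i - 2))%:Z)
        + 1)
   /\ q 1 = 0%N /\ q 2 = 1%N /\ q 3 = 3%N)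
  /\
  ((forall n : nat, (3 < n)%N ->
      (r n)%:Z = 3 * (r (n - 1))%:Z - (r (n - 2))%:Z + (q (n - 2))%:Z
        + \sum_(2 <= i < (n - 3).+1)
            (q i)%:Z * ((r (n - i - 1))%:Z - (r (n - i - 2))%:Z))
   /\ r 1 = 1%N /\ r 2 = 2%N /\ r 3 = 5%N).
Proof.
(* The terms of index 0 and 1 vanish since q 0 = q 1 = 0. *)
have drop2 k (F : nat -> int) :
    \sum_(0 <= a < k.+2) (q a)%:Z * F a = \sum_(2 <= a < k.+2) (q a)%:Z * F a.
  by rewrite big_ltn // big_ltn // q0 q1 !mul0r !add0r.
have idx k i : (k.+4 - i - 1 = k.+3 - i)%N /\ (k.+4 - i - 2 = k.+2 - i)%N.
  by lia.
split; split.
- case=> [|[|[|[|k]]]] // _.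
  rewrite q_recZ drop2 !subSS !subn0.
  have -> : \sum_(2 <= a < k.+2)
      (q a)%:Z * ((q (k.+3 - a))%:Z - (q (k.+2 - a))%:Z)
    = (q k.+1)%:Z + \sum_(2 <= i < k.+1)
      (q i)%:Z * ((q (k.+4 - i - 1))%:Z - (q (k.+4 - i - 2))%:Z).
    under [X in _ = _ + X]eq_bigr => i _ do rewrite (idx k i).1 (idx k i).2.
    (* For k > 0 the term a = k.+1 has factor q 2 - q 1 = 1. *)
    case: k => [|k]; first by rewrite !big_geq // q1.
    rewrite big_nat_recr //= addrC; congr (_ + _).
    have [e1 e2] : (k.+4 - k.+2 = 2)%N /\ (k.+3 - k.+2 = 1)%N by lia.
    by rewrite e1 e2 q2 q1 subr0 mulr1.
  move: (\sum_(_ <= a < _) _) => S; lia.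
- by rewrite q1 q2 q3.
- case=> [|[|[|[|k]]]] // _.
  rewrite r_recZ drop2 !subSS !subn0; congr (_ + _).
  by apply: eq_bigr => i _; rewrite (idx k i).1 (idx k i).2.
- by rewrite r1 r2 r3.
Qed.
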